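(* Consider the Erlang-A system. There exists an increasing function $C_K:\mathbb{R}_+\to\mathbb{R}_+$ such that for all integers $n\ge1$ and all $\lambda>0$, $\mu>0$, $\alpha>0$ satisfying $R\ge1$, $$d_K(\tilde X(\infty),Y(\infty))\le C_K(\alpha/\mu)\,\delta .$$
   Context: Erlang-A system: $n$ homogeneous servers, Poisson arrivals with rate $\lambda$, i.i.d. exponential service times with mean $1/\mu$, first-come-first-serve, and i.i.d. exponential patience times with mean $1/\alpha$, $\alpha>0$ (a customer whose waiting time in queue exceeds his patience time abandons). The customer count $X=\{X(t),t\ge0\}$ is the birth-death process on $\{0,1,2,\dots\}$ with birth rate $\lambda$ in every state and death rate $\mu(k\wedge n)+\alpha(k-n)^+$ in state $k$; it is positive recurrent and $X(\infty)$ denotes a random variable with its stationary distribution. Set $R=\lambda/\mu$, $\delta=1/\sqrt R$, and let $x(\infty)=n+\frac{\lambda-n\mu}{\alpha}$ if $R\ge n$ and $x(\infty)=R$ if $R<n$. Put $\tilde X(\infty)=\delta(X(\infty)-x(\infty))$ and $\zeta=\delta(x(\infty)-n)$. With $x^+=\max(x,0)$, $x^-=\max(-x,0)$, let $b(x)=\big((x+\zeta)^--\zeta^-\big)\mu-\big((x+\zeta)^+-\zeta^+\big)\alpha$. $Y(\infty)$ is a continuous random variable on $\mathbb{R}$ with density $\kappa\exp\big(\frac1\mu\int_0^xb(y)\,dy\big)$, $\kappa>0$ the normalizing constant. The Kolmogorov distance is $d_K(U,V)=\sup_{a\in\mathbb{R}}|\mathbb{P}(U\le a)-\mathbb{P}(V\le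 a)|$. *)

(* Defs.v *)
From HB Require Import structures.
From mathcomp Require Import all_boot all_order all_algebra.
From mathcomp Require Import all_classical all_reals all_analysis.
Set Implicit Arguments.
Unset Strict Implicit.
Unset Printing Implicit Defensive.
Import Order.TTheory GRing.Theory Num.Theory.
Import numFieldNormedType.Exports.
Local Open Scope classical_set_scope.
Local Open Scope ring_scope.

(* A continuous-time Markov chain on nat is given by its transition function
   P t i A = Pr(X(t) in A | X(0) = i); only the values at t >= 0 matter. *)
Record transition_function (R : realType) (P : R -> R.-pker nat ~> nat) : Prop := {
  transition0 : forall i (A : set nat), P 0 i A = (\d_i A)%E ;
  chapman_kolmogorov : forall (s t : R) i (A : set nat), 0 <= s -> 0 <= t ->
    P (s + t) i A = (\int[P s i]_j P t j A)%E }.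

Definition birth_death_rate (R : realType) (birth death : nat -> R) (i j : nat) : R :=
  if j == i.+1 then birth i
  else if i == j.+1 then death i
  else if i == j then - (birth i + death i)
  else 0.

(* The infinitesimal description
   P h i {j} = 1_{i = j} + birth_death_rate i j * h + o(h) as h -> 0+. *)
Record birth_death_process (R : realType) (birth death : nat -> R)
    (P : R -> R.-pker nat ~> nat) : Prop := {
  birth_death_transition : transition_function P ;
  birth_death_generator : forall i j : nat,
    (fine (P h i [set j]) - (i == j)%:R) / h @[h --> 0^'+]
      --> birth_death_rate birth death i j }.

Definition stationary (R : realType) (P : R -> R.-pker nat ~> nat)
    (pi : probability nat R) : Prop :=
  forall (t : R) (A : set nat), 0 <= t -> (\int[pi]_i P t i A)%E = pi A.

Definition kolmogorov_distance (R : realType)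
    (d : measure_display) (T : measurableType d) (P : probability T R)
    (d' : measure_display) (T' : measurableType d') (P' : probability T' R)
    (U : {RV P >-> R}) (V : {RV P' >-> R}) : R :=
  sup (range (fun a : R => `|fine (cdf U a) - fine (cdf V a)|)).

Definition has_density (R : realType) (d : measure_display)
    (T : measurableType d) (P : probability T R) (Y : {RV P >-> R}) (f : R -> R) : Prop :=
  forall A : set R, measurable A ->
    distribution P Y A = (\int[lebesgue_measure]_(x in A) (f x)%:E)%E.

(* \int_a^b f with the usual sign convention when b < a. *)
Definition oriented_integral (R : realType) (a b : R) (f : R -> R) : R :=
  if a <= b then \int[lebesgue_measure]_(y in `[a, b]) f y
  else - \int[lebesgue_measure]_(y in `[b, a]) f y.

Definition pos_part (R : realType) (x : R) : R := Num.max x 0.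
Definition neg_part (R : realType) (x : R) : R := Num.max (- x) 0.

Section affine_image.
Context (R : realType) (s c : R).

Definition centered_scaled (k : nat) : R := s * (k%:R - c).

Let measurable_centered_scaled : measurable_fun [set: nat] centered_scaled.
Proof. by []. Qed.

HB.instance Definition _ := isMeasurableFun.Build _ _ _ _
  centered_scaled measurable_centered_scaled.

End affine_image.

Section erlang_A.
Context (R : realType) (n : nat) (lambda mu alpha : R).

Definition erlangA_death (k : nat) : R := mu * (minn k n)%:R + alpha * (k - n)%:R.

Definition erlangA_process : (R -> R.-pker nat ~> nat) -> Prop :=
  birth_death_process (fun _ => lambda) erlangA_death.

Definition offered_load : R := lambda / mu.
Definition delta : R := 1 / Num.sqrt offered_load.

Definition fluid_equilibrium : R :=
  if n%:R <= offered_load then n%:R + (lambda - n%:R * mu) / alpha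
  else offered_load.

Definition zeta : R := delta * (fluid_equilibrium - n%:R).

Definition scaled_count (d : measure_display) (T : measurableType d)
    (P : probability T R) (X : {RV P >-> nat}) : {RV P >-> R} :=
  centered_scaled delta fluid_equilibrium \o X.

Definition drift (x : R) : R :=
  (neg_part (x + zeta) - neg_part zeta) * mu
  - (pos_part (x + zeta) - pos_part zeta) * alpha.

Definition diffusion_weight (x : R) : R :=
  expR (1 / mu * oriented_integral 0 x drift).

End erlang_A.

(* Main.v *)
Require Import Defs.
From mathcomp Require Import all_boot all_order all_algebra.
From mathcomp Require Import all_classical all_reals all_analysis.
From mathcomp Require Import measurable_realfun ring lra.
Set Implicit Arguments.
Unset Strict Implicit.
Unset Printing Implicit Defensive.
Import Order.TTheory GRing.Theory Num.Theory.
Import numFieldNormedType.Exports.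
Local Open Scope classical_set_scope.
Local Open Scope ring_scope.

(** The customer count and the diffusion are compared through their local
    growth rates.  In the unscaled coordinate [y = x / delta + x(oo)], let
    [z y] be the relative excess of the total death rate at level [y] over the
    arrival rate.  It is nondecreasing, vanishes at [x0 = x(oo)], and is
    Lipschitz with constant [e = (1 + alpha / mu) * delta ^ 2].  Detailed balance
    says that the stationary masses satisfy [p k = (1 + z (k + 1)) * p (k + 1)],
    while the density of [Y], a multiple of [expR (L y)], has logarithmic
    derivative [- z] in [y].  So both laws rise up to [x0] and fall after it, and they
    differ because [1 + z] is not [expR z] and because a sum is not an integral.
    Everything is normalised to height about 1 at the peak; the total mass is
    then at least of order [1 / Num.sqrt e].  It is enough to show that the
    unnormalised head sums (left of the peak) and tail sums (right of it) differ
    by [O(1)] plus [O(e)] times the total masses, since dividing by the mass gives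
    [O(Num.sqrt e + e) = O(delta)].

    The intermediary is the sequence [v] with [v k = expR (z (k + 1)) * v (k + 1)].
    - Between [p] and [v] each step costs a relative error
      [1 - (1 + z) * expR (- z) <= z ^ 2] ([defect_le_sqr]), so the total error is
      the sum over [j] of [z j ^ 2] times the mass beyond [j].  One factor [z j]
      is absorbed by telescoping: [z j] times the mass beyond [j] is at most the
      mass at the neighbour of [j] ([exp_head], [balanced_tail]).  What remains is
      a sum of [|z j|] times the mass at [j] or next to it, and this telescopes
      again, up to [e] times the total mass ([exp_gap_sum], [balanced_gap_sum]).
    - Between [v] and the weight [expR (L y)] only monotonicity of [z] is used:
      [v k] lies between the values of the weight at [k] and [k + 1], up to a
      factor [expR e] ([profile_left], [profile_right]).  Unimodality then gives
      sums within [O(1)] of integrals.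

    Detailed balance itself follows from stationarity and the rates at time 0:
    keeping finitely many starting states gives one inequality per state, which
    says that the net flux from [k + 1] to [k] is nonincreasing in [k].  This flux
    is at most 0 at the boundary and is bounded below by a null sequence, so it is
    zero ([detailed_balance]). *)

(** * Detailed balance against an exponential profile *)

(** Bound [expR (- x)] below by [1 - x]: the linear terms of the product cancel. *)
Lemma defect_le_sqr (R : realType) (x : R) : -1 <= x ->
  1 - (1 + x) * expR (- x) <= x ^+ 2.
Proof.
move=> x1; have := expR_ge1Dx (- x); have x0 : 0 <= 1 + x by lra.
by move=> /(ler_wpM2l x0); nra.
Qed.

Section balanced_vs_exponential.
Context (R : realType) (z u : nat -> R) (m : nat) (e : R).
Hypotheses
  (z_ndec : forall i j, (i <= j)%N -> z i <= z j) (z_step : forall k, z k.+1 <= z k + e)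
  (z_le0 : forall k, (k <= m)%N -> z k <= 0)
  (z_ge0 : forall k, (m < k)%N -> 0 <= z k)
  (z_geN1 : forall k, -1 <= z k).
Hypotheses (u_ge0 : forall k, 0 <= u k) (u_peak : u m = 1)
  (u_balance : forall k, u k = (1 + z k.+1) * u k.+1).

(** The sequence that would replace [u] if each ratio [1 + z] were [expR z],
    with the same value 1 at the index [m] where [z] changes sign. *)
Definition exp_profile k := expR (\sum_(j < m) z j.+1 - \sum_(j < k) z j.+1).
Local Notation v := exp_profile.

Lemma exp_profile_gt0 k : 0 < v k. Proof. exact: expR_gt0. Qed.

Lemma exp_profile_peak : v m = 1.
Proof. by rewrite /v subrr expR0. Qed.

Lemma exp_profileS k : v k = expR (z k.+1) * v k.+1.
Proof. by rewrite /v -expRD big_ord_recr /=; congr expR; ring. Qed.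

Lemma exp_profileS' k : v k.+1 = expR (- z k.+1) * v k.
Proof. by rewrite (exp_profileS k) mulrA -expRD addNr expR0 mul1r. Qed.

Lemma downward_ind (P : nat -> Prop) : P m ->
  (forall k, (k < m)%N -> P k.+1 -> P k) -> forall k, (k <= m)%N -> P k.
Proof.
move=> Pm PS k km; rewrite -(subKn km); move: (m - k)%N (leq_subr k m).
elim=> [|i IH] im; first by rewrite subn0.
apply: PS; first by rewrite ltn_subrL (leq_trans _ im).
by rewrite subnSK//; exact/IH/ltnW.
Qed.

Lemma upward_ind (P : nat -> Prop) : P m ->
  (forall k, (m <= k)%N -> P k -> P k.+1) -> forall k, (m <= k)%N -> P k.
Proof.
move=> Pm PS k mk; rewrite -(subnKC mk); elim: (k - m)%N => [|i IH].
  by rewrite addn0.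
by rewrite addnS; apply: PS => //; exact: leq_addr.
Qed.

(** Since [1 + z <= expR z], replacing the ratios can only raise the terms to
    the left of the peak, and only lower those to its right. *)
Lemma balanced_le_exp k : (k <= m)%N -> u k <= v k.
Proof.
move: k; apply: downward_ind => [|k km IH]; first by rewrite u_peak exp_profile_peak.
rewrite u_balance exp_profileS; apply: ler_pM => //; last exact: expR_ge1Dx.
by have := z_geN1 k.+1; lra.
Qed.

Lemma balanced_ge_exp k : (m <= k)%N -> v k <= u k.
Proof.
move: k; apply: upward_ind => [|k km IH]; first by rewrite u_peak exp_profile_peak.
have z1 : 0 < 1 + z k.+1 by have := @z_ge0 k.+1 km; lra.
rewrite -(ler_pM2l z1) -u_balance; apply: le_trans IH.
rewrite (exp_profileS k); apply: ler_wpM2r; first exact/ltW/exp_profile_gt0.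
exact: expR_ge1Dx.
Qed.

(** The relative gap grows by at most [z ^ 2] per step away from the peak, by
    [defect_le_sqr].  It is measured relative to [exp_profile] here and relative
    to [u] in [balanced_gap], each being the larger sequence on its side. *)
Lemma exp_gap k : (k <= m)%N ->
  v k - u k <= (\sum_(k <= j < m) z j.+1 ^+ 2) * v k.
Proof.
move: k; apply: downward_ind => [|k km IH].
  by rewrite big_geq// u_peak exp_profile_peak; lra.
rewrite big_ltn//; set S := \sum_(k.+1 <= j < m) z j.+1 ^+ 2 in IH *.
have S0 : 0 <= S by apply: sumr_ge0 => j _; exact: sqr_ge0.
have vk := exp_profile_gt0 k.
have H1 := defect_le_sqr (z_geN1 k.+1).
have H2 := expR_ge1Dx (z k.+1).
have z1 : 0 <= 1 + z k.+1 by have := z_geN1 k.+1; lra.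
have vk1 := exp_profile_gt0 k.+1.
have -> : v k - u k = (1 - (1 + z k.+1) * expR (- z k.+1)) * v k
   + (1 + z k.+1) * (v k.+1 - u k.+1).
  by rewrite (u_balance k) (exp_profileS' k); ring.
rewrite [leRHS]mulrDl; apply: lerD; first by apply: ler_wpM2r => //; exact: ltW.
apply: (@le_trans _ _ ((1 + z k.+1) * (S * v k.+1))).
  exact: ler_wpM2l.
rewrite mulrCA; apply: ler_wpM2l => //; rewrite [leRHS]exp_profileS.
by apply: ler_wpM2r => //; exact: ltW.
Qed.

Lemma balanced_gap k : (m <= k)%N ->
  u k - v k <= (\sum_(m <= j < k) z j.+1 ^+ 2) * u k.
Proof.
move: k; apply: upward_ind => [|k km IH].
  by rewrite big_geq// u_peak exp_profile_peak; lra.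
rewrite big_nat_recr//=; set S := \sum_(m <= j < k) z j.+1 ^+ 2 in IH *.
have S0 : 0 <= S by apply: sumr_ge0 => j _; exact: sqr_ge0.
have H1 := defect_le_sqr (z_geN1 k.+1).
have u1 := u_ge0 k.+1.
have -> : u k.+1 - v k.+1 = (1 - (1 + z k.+1) * expR (- z k.+1)) * u k.+1
   + expR (- z k.+1) * (u k - v k).
  by rewrite (u_balance k) (exp_profileS' k); ring.
rewrite [leRHS]mulrDl [leRHS]addrC; apply: lerD; first by apply: ler_wpM2r.
apply: (@le_trans _ _ (expR (- z k.+1) * (S * u k))).
  by apply: ler_wpM2l => //; exact: expR_ge0.
rewrite mulrCA; apply: ler_wpM2l => //; rewrite u_balance mulrA.
rewrite -[leRHS]mul1r; apply: ler_wpM2r => //.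
have := expR_ge1Dx (z k.+1) => /(ler_wpM2l (expR_ge0 (- z k.+1))).
by rewrite -expRD addNr expR0.
Qed.

(** As [- z] decreases towards the peak, [- z k] is at most each earlier [- z j],
    and [- z (j + 1) * v j <= v (j + 1) - v j] telescopes. *)
Lemma exp_head k : (k <= m)%N -> - z k * (\sum_(j < k) v j) <= v k.
Proof.
elim: k => [|k IH] km; first by rewrite big_ord0 mulr0 ltW// exp_profile_gt0.
rewrite big_ord_recr/= mulrDr.
have {}IH := IH (ltnW km).
have s0 : 0 <= \sum_(j < k) v j by apply: sumr_ge0 => j _; exact/ltW/exp_profile_gt0.
have H : - z k.+1 * \sum_(j < k) v j <= v k.
  by apply: le_trans IH; apply: ler_wpM2r => //; rewrite lerN2; exact: z_ndec.
rewrite exp_profileS'; have vk := exp_profile_gt0 k.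
have := ler_wpM2r (ltW vk) (expR_ge1Dx (- z k.+1)).
by rewrite mulrDl mul1r; lra.
Qed.

(** The same telescoping; the term [e] pays for the shift from [z (j + 1)] to [z j]. *)
Lemma exp_first_moment k : (k <= m)%N ->
  \sum_(j < k) - z j * v j <= v k + e * \sum_(j < k) v j.
Proof.
elim: k => [|k IH] km; first by rewrite !big_ord0 mulr0 addr0 ltW// exp_profile_gt0.
rewrite !big_ord_recr/= mulrDr.
have {}IH := IH (ltnW km); have vk := exp_profile_gt0 k.
have H := ler_wpM2r (ltW vk) (expR_ge1Dx (- z k.+1)).
rewrite -exp_profileS' in H.
have := ler_wpM2r (ltW vk) (z_step k).
by move: IH H; rewrite !mulrDl !mulNr !mul1r; lra.
Qed.

(** Exchanging the two sums turns the gaps of [exp_gap] into [z j ^ 2] times the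
    mass below [j]; [exp_head] removes one factor [z j], and the rest is a first
    moment. *)
Lemma exp_gap_sum :
  \sum_(k < m) (v k - u k) <= 1 + e + e * \sum_(k < m) v k.
Proof.
(* Exchange of the two sums, done by induction on the upper limit. *)
have L k : (k <= m)%N ->
    \sum_(i < k) (\sum_(i <= j < k) z j.+1 ^+ 2) * v i
      <= \sum_(j < k) - z j.+1 * v j.+1.
  elim: k => [|k IH] km; first by rewrite !big_ord0.
  rewrite [leRHS]big_ord_recr/= -mulrN1.
  have -> : \sum_(i < k.+1) (\sum_(i <= j < k.+1) z j.+1 ^+ 2) * v i
     = \sum_(i < k) (\sum_(i <= j < k) z j.+1 ^+ 2) * v i
      + z k.+1 ^+ 2 * \sum_(i < k.+1) v i.
    rewrite big_ord_recr/= big_nat1 big_ord_recr/= mulrDr addrA; congr (_ + _).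
    rewrite mulr_sumr -big_split; apply: eq_bigr => i _ /=.
    by rewrite big_nat_recr ?mulrDl// ltnW.
  apply: lerD; first exact/IH/ltnW.
  have := exp_head km; have := @z_le0 _ km => z0.
  have zN : 0 <= - z k.+1 by lra.
  by move=> /(ler_wpM2l zN); nra.
apply: (@le_trans _ _ (\sum_(j < m) - z j.+1 * v j.+1)).
  apply: le_trans (L m (leqnn m)); apply: ler_sum => i _.
  by apply: exp_gap; rewrite ltnW.
(* [exp_first_moment] starts at index 0 and stops before [m]; the term at [m] is
   at most [e] because [z] changes sign in the next step. *)
have -> : \sum_(j < m) - z j.+1 * v j.+1 = \sum_(j < m.+1) - z j * v j - (- z 0%N * v 0%N).
  by rewrite [in RHS]big_ord_recl/= addrC addKr.
rewrite big_ord_recr/= exp_profile_peak.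
have z0 := ler_wpM2r (ltW (exp_profile_gt0 0)) (@z_le0 0%N (leq0n m)).
have zm : - z m <= e by have := z_step m; have := z_ge0 (ltnSn m); lra.
have := exp_first_moment (leqnn m); rewrite exp_profile_peak; lra.
Qed.

(** Here detailed balance is an exact telescoping: [z j * u j = u (j - 1) - u j]. *)
Lemma balanced_tail k N : (m <= k)%N -> (k <= N)%N ->
  z k.+1 * (\sum_(k <= j < N) u j.+1) <= u k.
Proof.
move=> mk kN.
apply: (@le_trans _ _ (\sum_(k <= j < N) (- u j.+1 - - u j))); last first.
  by rewrite (telescope_sumr (fun j => - u j))//; have := u_ge0 N; lra.
rewrite mulr_sumr big_nat [leRHS]big_nat; apply: ler_sum => j /andP[kj _].
have -> : - u j.+1 - - u j = z j.+1 * u j.+1 by rewrite (u_balance j); ring.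
by apply: ler_wpM2r => //; exact: z_ndec.
Qed.

Lemma balanced_first_moment k : (m <= k)%N ->
  \sum_(m <= j < k.+1) z j * u j <= 1 - u k.
Proof.
move: k; apply: upward_ind => [|k mk IH].
  by rewrite big_nat1 u_peak; have := z_le0 (leqnn m); lra.
rewrite big_nat_recr/=; last exact: leqW.
by have := u_balance k; move: IH; lra.
Qed.

(** The mirror image of [exp_gap_sum], truncated at an arbitrary [N] so that only
    finite sums occur; [N] is later sent to infinity. *)
Lemma balanced_gap_sum N : (m <= N)%N ->
  \sum_(m <= k < N) (u k.+1 - v k.+1) <= 1 + e * \sum_(m <= k < N) u k.
Proof.
move=> mN; pose S k := \sum_(m <= j < k) z j.+1 ^+ 2.
pose T k := \sum_(k <= j < N) u j.+1.
(* Exchange of the two sums by induction on [k]: [S k * T k] is the part of the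
   double sum coupling indices up to [k] with indices after [k]. *)
have L k : (m <= k)%N -> (k <= N)%N ->
    \sum_(m <= i < k) S i.+1 * u i.+1 + S k * T k
      <= \sum_(m <= j < k) z j.+1 * u j.
  move: k; apply: upward_ind => [|k mk IH] kN.
    by rewrite /S !big_geq// mul0r addr0.
  rewrite !big_nat_recr//=.
  have TE : T k = u k.+1 + T k.+1 by rewrite /T big_ltn.
  have SE : S k.+1 = S k + z k.+1 ^+ 2 by rewrite /S big_nat_recr.
  have z0 : 0 <= z k.+1 by apply: z_ge0; rewrite ltnS.
  have := ler_wpM2l z0 (balanced_tail mk (ltnW kN)).
  have := IH (ltnW kN); rewrite -/(T k) SE TE; lra.
have {L}L := L N mN (leqnn N); rewrite /T [X in _ * X]big_geq// mulr0 addr0 in L.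
apply: (@le_trans _ _ (\sum_(m <= j < N) z j.+1 * u j)).
  apply: le_trans L; rewrite big_nat [leRHS]big_nat; apply: ler_sum => k /andP[mk _].
  by apply: balanced_gap; exact: leqW.
apply: (@le_trans _ _ (\sum_(m <= j < N) (z j * u j + e * u j))).
  by apply: ler_sum => j _; rewrite -mulrDl; exact: ler_wpM2r.
rewrite big_split/= -mulr_sumr; apply: lerD => //.
move: mN; rewrite leq_eqVlt => /predU1P[<-|]; first by rewrite big_geq.
case: (N) => // N'; rewrite ltnS => /balanced_first_moment/le_trans; apply.
by have := u_ge0 N'; lra.
Qed.

End balanced_vs_exponential.

(** * Log-concave weights on the line *)

(** [L] is a logarithmic density with [L' = - z], peaked at [x0].  The derivative is
    stated through bounds on increments, the form in which the drift integral gives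
    it.  The value [-1] of [z] at 0 (no deaths from the empty state) makes the weight
    decay geometrically on the negative half-line. *)
Record log_concave_potential (R : realType) (z L : R -> R) (x0 e : R) : Prop := {
  lcp_e_gt0 : 0 < e ;
  lcp_x0_ge0 : 0 <= x0 ;
  lcp_z_x0 : z x0 = 0 ;
  lcp_L_x0 : L x0 = 0 ;
  lcp_z_0 : z 0 = -1 ;
  lcp_z_ndec : forall x y, x <= y -> z x <= z y ;
  lcp_z_lip : forall x y, x <= y -> z y <= z x + e * (y - x) ;
  lcp_L_ub : forall x y, x <= y -> L y - L x <= - (y - x) * z x ;
  lcp_L_lb : forall x y, x <= y -> - (y - x) * z y <= L y - L x }.

(** [h] is the distribution function of the measure with density [expR (L t)], whose
    total mass is at most [M]. *)
Record weight_distribution (R : realType) (L h : R -> R) (M : R) : Prop := {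
  wd_ub : forall x y c, x <= y -> (forall t, x <= t <= y -> L t <= c) ->
    h y - h x <= (y - x) * expR c ;
  wd_lb : forall x y c, x <= y -> (forall t, x <= t <= y -> c <= L t) ->
    (y - x) * expR c <= h y - h x ;
  wd_mono : forall x y, x <= y -> h x <= h y ;
  wd_ge0 : forall x, 0 <= h x ;
  wd_leM : forall x, h x <= M ;
  wd_Ny : h (- n%:R) @[n --> \oo] --> (0 : R) }.

Section log_concave_weight.
Context (R : realType) (z L : R -> R) (x0 e : R).
Hypothesis LCP : log_concave_potential z L x0 e.
Let e_gt0 := lcp_e_gt0 LCP.
Let x0_ge0 := lcp_x0_ge0 LCP.
Let z_x0 := lcp_z_x0 LCP.
Let L_x0 := lcp_L_x0 LCP.
Let z_0 := lcp_z_0 LCP.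
Let z_ndec := lcp_z_ndec LCP.
Let z_lip := lcp_z_lip LCP.
Let L_ub := lcp_L_ub LCP.
Let L_lb := lcp_L_lb LCP.

Lemma L_le0 y : L y <= 0.
Proof.
have [yx|xy] := leP y x0.
  by have := L_lb yx; rewrite z_x0 L_x0; lra.
by have := L_ub (ltW xy); rewrite z_x0 L_x0; lra.
Qed.

Lemma weight_le1 y : expR (L y) <= 1.
Proof. by rewrite -expR0 ler_expR L_le0. Qed.

Lemma L_incr x y : x <= y -> y <= x0 -> L x <= L y.
Proof.
move=> xy yx0; have := L_lb xy; have := z_ndec yx0; rewrite z_x0 => zy.
by nra.
Qed.

Lemma L_decr x y : x <= y -> x0 <= x -> L y <= L x.
Proof.
move=> xy x0x; have := L_ub xy; have := z_ndec x0x; rewrite z_x0 => zy.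
by nra.
Qed.

(** [z] vanishes at [x0] and is [e]-Lipschitz, so the fall is at most quadratic. *)
Lemma L_near_peak y : x0 <= y -> - (e * (y - x0) ^+ 2) <= L y.
Proof.
move=> x0y; have := L_lb x0y; have := z_lip x0y.
by rewrite z_x0 L_x0; nra.
Qed.

Local Notation m := (Num.truncn x0).
Local Notation zn := (fun k : nat => z k%:R).
Local Notation v := (exp_profile zn m).

Let m_le : m%:R <= x0. Proof. by have /andP[] := truncn_itv x0_ge0. Qed.
Let lt_m : x0 < m.+1%:R. Proof. by have /andP[] := truncn_itv x0_ge0. Qed.

Lemma zn_ndec i j : (i <= j)%N -> zn i <= zn j.
Proof. by move=> ij; apply: z_ndec; rewrite ler_nat. Qed.

Lemma zn_step k : zn k.+1 <= zn k + e.
Proof.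
have := @z_lip k%:R k.+1%:R; rewrite ler_nat => /(_ (leqnSn k)).
by rewrite -(natr1 k); lra.
Qed.

Lemma zn_le0 k : (k <= m)%N -> zn k <= 0.
Proof.
by move=> km; rewrite -z_x0; apply: z_ndec; apply: le_trans m_le; rewrite ler_nat.
Qed.

Lemma zn_ge0 k : (m < k)%N -> 0 <= zn k.
Proof.
move=> km; rewrite -[leLHS]z_x0; apply: z_ndec; apply: (le_trans (ltW lt_m)).
by rewrite ler_nat.
Qed.

Lemma zn_geN1 k : -1 <= zn k.
Proof. by rewrite -z_0; apply: z_ndec. Qed.

Let L_m : - e <= L m%:R.
Proof.
have := L_ub m_le; have := z_lip m_le; rewrite z_x0 L_x0.
have := zn_le0 (leqnn m); have := lt_m; have := m_le; rewrite -natr1.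
set d := x0 - m%:R => ? ? z0 zd Ld; have d0 : 0 <= d by rewrite /d; lra.
have d1 : d <= 1 by rewrite /d; lra.
by have := ler_wpM2l (ltW e_gt0) d1; nra.
Qed.

Let L_m1 : - e <= L m.+1%:R.
Proof.
apply: le_trans (L_near_peak (ltW lt_m)); rewrite lerN2 ler_piMr ?(ltW e_gt0)//.
have := lt_m; have := m_le; rewrite -natr1 => ? ?.
by rewrite exprn_ile1//; lra.
Qed.

Let L_next k : - zn k.+1 <= L k.+1%:R - L k%:R <= - zn k.
Proof.
have k1 : (k%:R : R) <= k.+1%:R by rewrite ler_nat.
have := L_ub k1; have := L_lb k1.
have -> : (k.+1%:R : R) - k%:R = 1 by rewrite -natr1; ring.
by move=> ? ?; apply/andP; split; lra.
Qed.

Let lnv k := \sum_(j < m) zn j.+1 - \sum_(j < k) zn j.+1.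

Let lnvS k : lnv k.+1 = lnv k - zn k.+1.
Proof. by rewrite /lnv big_ord_recr/=; ring. Qed.

Let lnv_m : lnv m = 0. Proof. by rewrite /lnv subrr. Qed.

(** On each cell [- z] lies between its values at the two ends, so the sum defining
    the profile lies between the increments of [L] over the cells to the left and
    over the cells to the right.  The factor [expR e] is the price of normalising at
    [m] or [m + 1] instead of at the true peak [x0] between them. *)
Lemma profile_left k : (k <= m)%N ->
  expR (L k%:R) <= v k <= expR e * expR (L k.+1%:R).
Proof.
move=> km; rewrite -expRD !ler_expR -/(lnv k).
suff [] : L k%:R - L m%:R <= lnv k /\ lnv k <= L k.+1%:R - L m.+1%:R.
  by have := L_le0 m%:R; have := L_m1 => *; apply/andP; split; lra.
move: k km; apply: downward_ind => [|k km [IH1 IH2]].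
  by rewrite lnv_m; split; lra.
rewrite lnvS in IH1 IH2.
have /andP[? ?] := L_next k; have /andP[? ?] := L_next k.+1; split; lra.
Qed.

Lemma profile_right k : (m <= k)%N ->
  expR (L k.+1%:R) <= v k <= expR e * expR (L k%:R).
Proof.
move=> km; rewrite -expRD !ler_expR -/(lnv k).
suff [] : L k.+1%:R - L m.+1%:R <= lnv k /\ lnv k <= L k%:R - L m%:R.
  by have := L_le0 m.+1%:R; have := L_m => *; apply/andP; split; lra.
move: k km; apply: upward_ind => [|k km [IH1 IH2]].
  by rewrite lnv_m; split; lra.
rewrite lnvS.
have /andP[? ?] := L_next k; have /andP[? ?] := L_next k.+1; split; lra.
Qed.

Context (h : R -> R) (M : R).
Hypothesis WD : weight_distribution L h M.
Let h_ub := wd_ub WD.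
Let h_lb := wd_lb WD.
Let h_mono := wd_mono WD.
Let h_ge0 := wd_ge0 WD.
Let h_leM := wd_leM WD.
Let h_Ny := wd_Ny WD.

Lemma h_lip x y : x <= y -> h y - h x <= y - x.
Proof.
move=> xy; rewrite -[leRHS]mulr1 -expR0; apply: h_ub => // t _; exact: L_le0.
Qed.

Let natS (k : nat) : (k%:R : R) <= k.+1%:R. Proof. by rewrite ler_nat. Qed.
Let natS1 (k : nat) : (k.+1%:R : R) - k%:R = 1. Proof. by rewrite -natr1; ring. Qed.

Lemma h_cell_left k : (k < m)%N ->
  expR (L k%:R) <= h k.+1%:R - h k%:R <= expR (L k.+1%:R).
Proof.
move=> km; have k1x0 : k.+1%:R <= x0 by apply: le_trans m_le; rewrite ler_nat.
have := h_ub (c := L k.+1%:R) (natS k).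
have := h_lb (c := L k%:R) (natS k).
rewrite natS1 !mul1r => lb ub; apply/andP; split.
  by apply: lb => t /andP[kt tk]; apply: L_incr => //; exact: le_trans k1x0.
by apply: ub => t /andP[kt tk]; exact: L_incr.
Qed.

Lemma h_cell_right k : (m < k)%N ->
  expR (L k.+1%:R) <= h k.+1%:R - h k%:R <= expR (L k%:R).
Proof.
move=> km; have kx0 : x0 <= k%:R by apply: le_trans (ltW lt_m) _; rewrite ler_nat.
have := h_ub (c := L k%:R) (natS k).
have := h_lb (c := L k.+1%:R) (natS k).
rewrite natS1 !mul1r => lb ub; apply/andP; split.
  by apply: lb => t /andP[kt tk]; apply: L_decr => //; exact: le_trans kt.
by apply: ub => t /andP[kt tk]; exact: L_decr.
Qed.

(* [L (- n) <= - n], and [expR (- 1) <= 1 / 2]. *)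
Let h_dyadic (n : nat) : h 0 - h (- n%:R) <= 2 - 2 * 2^-1 ^+ n.
Proof.
elim: n => [|n IH]; first by rewrite oppr0 expr0; lra.
have nn : - n.+1%:R <= - n%:R :> R by rewrite lerN2.
have L0n : L (- n%:R) <= - n%:R.
  have n0 : - n%:R <= 0 :> R by rewrite oppr_le0.
  by have := L_lb n0; rewrite z_0; have := L_le0 0; lra.
have en : expR (- n%:R) <= 2^-1 ^+ n :> R.
  rewrite -mulrN1 expRM_natl.
  apply: lerXn2r; rewrite ?nnegrE ?expR_ge0 ?invr_ge0//.
  rewrite expRN lef_pV2 ?posrE ?expR_gt0//.
  by have := expR_ge1Dx (1 : R); lra.
have := h_ub (c := - n%:R) nn; have -> : - n%:R - - n.+1%:R = 1 :> R.
  by rewrite -natr1; ring.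
rewrite mul1r exprS => H; apply: (@le_trans _ _ ((h 0 - h (- n%:R)) + expR (- n%:R))).
  suff : h (- n%:R) - h (- n.+1%:R) <= expR (- n%:R) by lra.
  apply: H => t /andP[_ tn]; apply: le_trans L0n.
  by apply: L_incr => //; apply: le_trans x0_ge0; rewrite oppr_le0.
by move: IH en; lra.
Qed.

(** The mass on the negative half-line is bounded although the chain has none there. *)
Lemma h0_le2 : h 0 <= 2.
Proof.
suff : h 0 - 0 <= 2 by rewrite subr0.
have hc : h 0 - h (- n%:R) @[n --> \oo] --> h 0 - 0.
  by apply: cvgB => //; exact: cvg_cst.
apply: (cvgr_to_le hc); apply: nearW => n; apply: le_trans (h_dyadic n) _.
by rewrite lerBlDr lerDl mulr_ge0// exprn_ge0.
Qed.

Lemma weight_sum_le n : (n <= m)%N -> \sum_(k < n) expR (L k%:R) <= h n%:R.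
Proof.
elim: n => [|n IH] nm; first by rewrite big_ord0.
rewrite big_ord_recr/=; have /andP[H _] := h_cell_left nm.
by have := IH (ltnW nm); lra.
Qed.

Lemma weight_sum_ge n : (n <= m)%N ->
  h n%:R - 2 <= \sum_(k < n.+1) expR (L k%:R).
Proof.
elim: n => [|n IH] nm.
  by rewrite big_ord_recr big_ord0/= add0r; have := expR_ge0 (L 0); have := h0_le2; lra.
rewrite big_ord_recr/=; have /andP[_ H] := h_cell_left nm.
by have := IH (ltnW nm); lra.
Qed.

(** The sum of a unimodal weight over lattice points is within a bounded distance of
    its integral.  The constants here and in the next three lemmas come from the cells
    at the peak or lost by a shift, each of mass at most 1, and from [h0_le2]. *)
Lemma profile_sum_le n : (n <= m)%N -> \sum_(k < n.+1) v k <= expR e * (h n%:R + 2).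
Proof.
move=> nm; apply: (@le_trans _ _ (expR e * \sum_(k < n.+1) expR (L k.+1%:R))).
  rewrite mulr_sumr; apply: ler_sum => k _.
  by have /andP[] := profile_left (leq_trans (leq_ord k) nm).
apply: ler_wpM2l; first exact: expR_ge0.
have := weight_sum_le nm; have := weight_le1 n%:R; have := weight_le1 n.+1%:R.
have : \sum_(k < n.+2) expR (L k%:R) = expR (L 0) + \sum_(k < n.+1) expR (L k.+1%:R).
  by rewrite big_ord_recl.
by rewrite !big_ord_recr/=; have := expR_ge0 (L 0); lra.
Qed.

Lemma profile_sum_ge n : (n <= m)%N -> h n%:R - 2 <= \sum_(k < n.+1) v k.
Proof.
move=> nm; apply: le_trans (weight_sum_ge nm) _; apply: ler_sum => k _.
by have /andP[] := profile_left (leq_trans (leq_ord k) nm).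
Qed.

Lemma profile_tail_le n N : (m <= n)%N -> (n <= N)%N ->
  \sum_(n <= k < N) v k.+1 <= expR e * (1 + (M - h n%:R)).
Proof.
move=> mn nN; apply: (@le_trans _ _ (expR e * \sum_(n <= k < N) expR (L k.+1%:R))).
  rewrite mulr_sumr big_nat [leRHS]big_nat; apply: ler_sum => k /andP[nk _].
  by have /andP[] := profile_right (leqW (leq_trans mn nk)).
apply: ler_wpM2l; first exact: expR_ge0.
apply: (@le_trans _ _ (1 + (h N%:R - h n%:R))); last by have := h_leM N%:R; lra.
elim: N nN => [|N IH]; first by rewrite leqn0 => /eqP ->; rewrite big_geq// subrr addr0.
rewrite leq_eqVlt => /predU1P[<-|]; first by rewrite big_geq// subrr addr0.
rewrite ltnS => nN; rewrite big_nat_recr//=; have {}IH := IH nN.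
move: nN; rewrite leq_eqVlt => /predU1P[nN|nN].
  rewrite -nN big_geq//.
  by have := weight_le1 n.+1%:R; have := h_mono (natS n); lra.
by have /andP[H _] := h_cell_right (leq_ltn_trans mn nN); lra.
Qed.

Lemma profile_tail_ge n N : (m <= n)%N -> (n <= N)%N ->
  h N%:R - h n%:R - 2 <= \sum_(n <= k < N) v k.+1.
Proof.
move=> mn nN.
have hlip k : h k.+1%:R - h k%:R <= 1 by rewrite -[leRHS](natS1 k); apply: h_lip.
suff : h N.+2%:R - h n.+2%:R <= \sum_(n <= k < N) v k.+1.
  have := @h_mono N%:R N.+2%:R; rewrite ler_nat => /(_ (leqW (leqnSn N))).
  by have := hlip n; have := hlip n.+1; lra.
elim: N nN => [|N IH]; first by rewrite leqn0 => /eqP ->; rewrite big_geq// subrr.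
rewrite leq_eqVlt => /predU1P[<-|]; first by rewrite big_geq// subrr.
rewrite ltnS => nN; rewrite big_nat_recr//=; have {}IH := IH nN.
have mN : (m < N.+2)%N by rewrite ltnS leqW// (leq_trans mn).
have /andP[H1 H2] := profile_right (leqW (leq_trans mn nN)).
have /andP[H3 H4] := h_cell_right mN; lra.
Qed.

End log_concave_weight.

(** * Balanced sequences against log-concave laws *)

(** Either of the two normalisations may be used to compare the normalised values,
    so the smaller multiplier is available; this matters because the errors contain
    [e] times each of the two total masses. *)
Lemma rescaled_dist_le (R : realType) (a b q g K K' : R) :
  0 <= a <= 1 -> 0 <= b <= 1 -> 0 < q -> 0 < g ->
  `|a / q - b / g| <= K -> `|q^-1 - g^-1| <= K' ->
  `|a - b| <= Num.min q g * (K + K').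
Proof.
move=> /andP[a0 a1] /andP[b0 b1] q0 g0 abK qgK.
have K'0 : 0 <= K' by apply: le_trans qgK.
rewrite /Num.min; case: ifP => _.
  have -> : a - b = q * ((a / q - b / g) + - b * (q^-1 - g^-1)).
    by field; rewrite !gt_eqF.
  rewrite normrM gtr0_norm//; apply: ler_wpM2l; first exact: ltW.
  apply: le_trans (ler_normD _ _) _; apply: lerD => //.
  rewrite normrM normrN (ger0_norm b0) -[leRHS]mul1r.
  by apply: ler_pM.
have -> : a - b = g * ((a / q - b / g) + - a * (q^-1 - g^-1)).
  by field; rewrite !gt_eqF.
rewrite normrM gtr0_norm//; apply: ler_wpM2l; first exact: ltW.
apply: le_trans (ler_normD _ _) _; apply: lerD => //.
rewrite normrM normrN (ger0_norm a0) -[leRHS]mul1r.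
by apply: ler_pM.
Qed.

Section balanced_vs_log_concave.
Context (R : realType) (z L h : R -> R) (x0 e M : R) (p : nat -> R).
Hypotheses (LCP : log_concave_potential z L x0 e) (WD : weight_distribution L h M)
  (M_gt0 : 0 < M) (h_y : h n%:R @[n --> \oo] --> M).
Hypotheses (p_ge0 : forall k, 0 <= p k)
  (p_balance : forall k, p k = (1 + z k.+1%:R) * p k.+1)
  (p_sum1 : \sum_(k < n) p k @[n --> \oo] --> (1 : R)).

Local Notation m := (Num.truncn x0).
Local Notation zn := (fun k : nat => z k%:R).
Local Notation v := (exp_profile zn m).
Local Notation q := (p m).
Local Notation B := (expR e).

Let e_gt0 := lcp_e_gt0 LCP.
Let h_ge0 := wd_ge0 WD.
Let h_leM := wd_leM WD.

Let p_psum_le1 n : \sum_(k < n) p k <= 1.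
Proof.
apply: (cvgr_to_ge p_sum1); near=> N.
rewrite -(big_mkord xpredT p) -(big_mkord xpredT p).
rewrite [leRHS](@big_cat_nat _ _ _ n)//=; last by near: N; exact: nbhs_infty_ge.
by rewrite lerDl sumr_ge0.
Unshelve. all: by end_near. Qed.

(* If the mass at [m] vanished, the balance equations would make all masses vanish. *)
Let q_gt0 : 0 < q.
Proof.
rewrite lt_neqAle p_ge0 andbT eq_sym; apply/negP => /eqP q0.
have p0 k : p k = 0.
  have [km|/ltnW mk] := leqP k m.
    move: k km; apply: downward_ind => // k km IH.
    by rewrite p_balance IH mulr0.
  move: k mk; apply: upward_ind => // k mk IH.
  have z1 : 1 + z k.+1%:R != 0.
    by rewrite gt_eqF// ltr_pwDl// (zn_ge0 LCP)// ltnS.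
  by apply/eqP; have /eqP := p_balance k; rewrite IH eq_sym mulf_eq0 (negPf z1).
have : (0 : R) = 1.
  have H1 : \sum_(k < n) p k @[n --> \oo] --> (0 : R).
    under eq_fun do (rewrite big1 => [|i _]; last exact: p0).
    exact: cvg_cst.
  exact: cvg_unique H1 p_sum1.
by move/eqP; rewrite eq_sym oner_eq0.
Qed.

Let u k := p k / q.
Let u_ge0 k : 0 <= u k. Proof. by rewrite divr_ge0. Qed.
Let u_peak : u m = 1. Proof. by rewrite /u divff// gt_eqF. Qed.
Let u_balance k : u k = (1 + zn k.+1) * u k.+1.
Proof. by rewrite /u mulrA -p_balance. Qed.

Let B_ge1 : 1 <= B. Proof. by rewrite -expR0 ler_expR ltW. Qed.
Let B_sub1 : B - 1 <= e * B.
Proof.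
have := ler_wpM2r (expR_ge0 e) (expR_ge1Dx (- e)).
by rewrite -expRD addNr expR0 mulrDl mul1r; lra.
Qed.
Let B_h x : 0 <= x -> x <= M -> B * x <= x + e * B * M.
Proof.
move=> x_ge0 xM; suff : (B - 1) * x <= e * B * M by rewrite mulrBl; lra.
by apply: ler_pM => //; rewrite subr_ge0.
Qed.

Let u_sumE n : (\sum_(k < n) p k) / q = \sum_(k < n) u k.
Proof. by rewrite mulr_suml. Qed.

(** Left of the peak the chain is compared with the weight through head sums, and
    right of it through tail sums ([tail_dist]): each gap bound controls only its
    own side of the peak. *)
Lemma head_dist n : (n <= m)%N ->
  `|(\sum_(k < n.+1) p k) / q - h n%:R| <= e * B * M + (2 * B + 3 + e + 2 * (e * B)).
Proof.
move=> nm; rewrite u_sumE.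
have uv := balanced_le_exp (zn_geN1 LCP) u_ge0 u_peak u_balance.
have up : \sum_(k < n.+1) u k <= \sum_(k < n.+1) v k.
  by apply: ler_sum => k _; apply: uv; exact: leq_trans (leq_ord k) nm.
have low : \sum_(k < n.+1) (v k - u k) <= \sum_(k < m) (v k - u k).
  apply: (@le_trans _ _ (\sum_(k < m.+1) (v k - u k))).
    rewrite -!(big_mkord xpredT (fun k => v k - u k)).
    rewrite [leRHS](@big_cat_nat _ _ _ n.+1)//= lerDl big_nat sumr_ge0// => k /andP[_ km].
    by rewrite subr_ge0 uv.
  by rewrite big_ord_recr/= exp_profile_peak u_peak subrr addr0.
have := exp_gap_sum (zn_ndec LCP) (zn_step LCP) (zn_le0 LCP) (zn_ge0 LCP)
  (zn_geN1 LCP) u_peak u_balance.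
have vm : \sum_(k < m) v k <= B * (h m%:R + 2).
  apply: le_trans (profile_sum_le LCP WD (leqnn m)).
  by rewrite big_ord_recr/= lerDl; exact/ltW/exp_profile_gt0.
have Ph := profile_sum_ge LCP WD nm.
have Pl := profile_sum_le LCP WD nm.
move: low; rewrite [leLHS]sumrB => low gap.
have := ler_wpM2l (ltW e_gt0) vm.
have := B_h (h_ge0 n%:R) (h_leM n%:R).
have : e * B * h m%:R <= e * B * M.
  by apply: ler_wpM2l => //; rewrite mulr_ge0 ?expR_ge0// ltW.
have : 0 <= e * B by rewrite mulr_ge0 ?expR_ge0// ltW.
have := B_ge1; have : 0 < e by [].
by rewrite ler_norml => *; apply/andP; split; lra.
Qed.

Lemma tail_dist n : (m <= n)%N ->
  `|(1 - \sum_(k < n.+1) p k) / q - (M - h n%:R)| <= e * B * M + e / q + (B + 2).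
Proof.
move=> mn.
have tailE N : (n <= N)%N ->
    \sum_(n <= k < N) u k.+1 = (\sum_(k < N.+1) p k - \sum_(k < n.+1) p k) / q.
  move=> nN; rewrite -!(big_mkord xpredT p) [X in (X - _) / _](@big_cat_nat _ _ _ n.+1)//=.
  by rewrite addrAC subrr add0r big_add1/= mulr_suml.
have tail_cvg : \sum_(n <= k < N) u k.+1 @[N --> \oo] -->
    (1 - \sum_(k < n.+1) p k) / q.
  have shifted : (\sum_(k < N.+1) p k - \sum_(k < n.+1) p k) / q @[N --> \oo] -->
    (1 - \sum_(k < n.+1) p k) / q.
    apply: cvgM; last exact: cvg_cst.
    apply: cvgB; last exact: cvg_cst.
    by rewrite (cvg_shiftS (fun N => \sum_(k < N) p k)).
  apply: cvg_trans shifted; apply: near_eq_cvg; near=> N; rewrite /= tailE//.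
  by near: N; exact: nbhs_infty_ge.
have u_tot N : \sum_(m <= k < N) u k <= q^-1.
  rewrite -[leRHS]mul1r; apply: (@le_trans _ _ (\sum_(0 <= k < N) u k)).
    have [mN|Nm] := leqP m N; last by rewrite big_geq ?sumr_ge0// ltnW.
    by rewrite [leRHS](@big_cat_nat _ _ _ m)//= lerDr sumr_ge0.
  by rewrite big_mkord -u_sumE ler_pM2r ?invr_gt0.
have vu := balanced_ge_exp (zn_ge0 LCP) u_peak u_balance.
have gap N : (n <= N)%N -> \sum_(n <= k < N) (u k.+1 - v k.+1) <= 1 + e / q.
  move=> nN; apply: (@le_trans _ _ (\sum_(m <= k < N) (u k.+1 - v k.+1))).
    rewrite [leRHS](@big_cat_nat _ _ _ n)//= lerDr big_nat sumr_ge0// => k /andP[mk _].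
    by rewrite subr_ge0 vu// leqW.
  apply: le_trans (balanced_gap_sum (zn_ndec LCP) (zn_step LCP) (zn_le0 LCP) (zn_ge0 LCP)
    (zn_geN1 LCP) u_ge0 u_peak u_balance (leq_trans mn nN)) _.
  by rewrite lerD2l ler_pM2l.
rewrite ler_norml; apply/andP; split.
  rewrite lerBrDr.
  have hc : h N%:R - h n%:R - 2 @[N --> \oo] --> M - h n%:R - 2.
    by apply: cvgB; [apply: cvgB => //|]; exact: cvg_cst.
  have := ler_cvg_to hc tail_cvg => H.
  have : M - h n%:R - 2 <= (1 - \sum_(k < n.+1) p k) / q.
    apply: H; near=> N; have nN : (n <= N)%N by near: N; exact: nbhs_infty_ge.
    apply: le_trans (profile_tail_ge LCP WD mn nN) _.
    rewrite big_nat [leRHS]big_nat; apply: ler_sum => k /andP[nk _].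
    by rewrite vu// leqW// (leq_trans mn).
  have : 0 <= e / q by rewrite divr_ge0// ltW.
  have : 0 <= e * B * M by rewrite !mulr_ge0 ?expR_ge0// ltW.
  by have := B_ge1; lra.
rewrite lerBlDr; apply: (cvgr_to_le tail_cvg); near=> N.
have nN : (n <= N)%N by near: N; exact: nbhs_infty_ge.
have := gap N nN; rewrite sumrB.
have := profile_tail_le LCP WD mn nN; rewrite mulrDr mulr1.
have := @B_h (M - h n%:R); rewrite subr_ge0 gerBl h_leM h_ge0 => /(_ isT isT).
by lra.
Unshelve. all: by end_near. Qed.

Let F n := \sum_(k < n.+1) p k.

Let F01 n : 0 <= F n <= 1. Proof. by rewrite sumr_ge0//= p_psum_le1. Qed.

Let hM01 x : 0 <= h x / M <= 1.
Proof. by rewrite divr_ge0 ?(ltW M_gt0)//= ler_pdivrMr// mul1r h_leM. Qed.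

(** At [n = m] the head and tail bounds add up to a comparison of the total masses
    [1 / p m] and [M], which is what [rescaled_dist_le] needs besides one of them. *)
Lemma lattice_dist n :
  `|F n - h n%:R / M| <= 4 * (e * B + e) + (6 * B + 10 + 2 * e + 4 * (e * B)) / M.
Proof.
have hMK x : (h x / M) / M^-1 = h x by rewrite invrK divfK// gt_eqF.
have HL := head_dist (leqnn m); have HR := tail_dist (leqnn m).
have HK : `|q^-1 - M^-1^-1| <= (e * B * M + (2 * B + 3 + e + 2 * (e * B)))
    + (e * B * M + e / q + (B + 2)).
  rewrite invrK; have -> : q^-1 - M = (F m / q - h m%:R) + ((1 - F m) / q - (M - h m%:R)).
    by rewrite /F; ring.
  by apply: le_trans (ler_normD _ _) _; exact: lerD.
have Mi : 0 < M^-1 by rewrite invr_gt0.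
have main K : `|F n - h n%:R / M| <= Num.min q M^-1 * (K + ((e * B * M + (2 * B + 3 + e + 2 * (e * B)))
    + (e * B * M + e / q + (B + 2)))) -> K <= (e * B * M + (2 * B + 3 + e + 2 * (e * B)))
    + (e * B * M + e / q + (B + 2)) ->
  `|F n - h n%:R / M| <= 4 * (e * B + e) + (6 * B + 10 + 2 * e + 4 * (e * B)) / M.
  move=> /le_trans + KK; apply.
  set w := Num.min _ _; have w0 : 0 < w by rewrite lt_min q_gt0.
  have wM : w * M <= 1.
    by rewrite -(mulVf (lt0r_neq0 M_gt0)) ler_pM2r// ge_min lexx orbT.
  have wq : w / q <= 1 by rewrite ler_pdivrMr// mul1r ge_min lexx.
  have wM' : w <= M^-1 by rewrite ge_min lexx orbT.
  have eB : 0 <= e * B by rewrite mulr_ge0 ?expR_ge0// ltW.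
  have H1 := ler_wpM2l eB wM; have H2 := ler_wpM2l (ltW e_gt0) wq.
  have c0 : 0 <= 6 * B + 10 + 2 * e + 4 * (e * B) by have := B_ge1; have := e_gt0; lra.
  have H3 := ler_wpM2l c0 wM'.
  have e0 : 0 < e := e_gt0.
  have := ler_wpM2l (ltW w0) KK; lra.
have [nm|/ltnW mn] := leqP n m.
  apply: (main (e * B * M + (2 * B + 3 + e + 2 * (e * B)))).
    apply: rescaled_dist_le => //; rewrite hMK; exact: head_dist.
  by rewrite lerDl !addr_ge0// ?divr_ge0 ?mulr_ge0 ?expR_ge0// ltW.
apply: (main (e * B * M + e / q + (B + 2))).
  rewrite -normrN opprB; have -> : h n%:R / M - F n = (1 - F n) - (1 - h n%:R / M) by ring.
  apply: rescaled_dist_le => //.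
  - by have /andP[? ?] := F01 n; apply/andP; split; lra.
  - by have /andP[? ?] := hM01 n%:R; apply/andP; split; lra.
  rewrite [X in _ - X]mulrBl hMK mul1r invrK; exact: tail_dist.
rewrite lerDr !addr_ge0// ?mulr_ge0 ?expR_ge0//; rewrite ?ltW//.
Qed.

(** The weight stays above [expR (-1)] at distance [1 / Num.sqrt e] from its peak, so
    its mass is at least of that order. *)
Lemma peak_height_le : M^-1 <= expR 1 * Num.sqrt e.
Proof.
have se : 0 < Num.sqrt e by rewrite sqrtr_gt0.
rewrite -[leRHS]invrK lef_pV2 ?posrE ?invr_gt0 ?mulr_gt0 ?expR_gt0// invfM -expRN.
pose t := (Num.sqrt e)^-1; rewrite mulrC -/t.
have t0 : 0 < t by rewrite invr_gt0.
have x0t : x0 <= x0 + t by rewrite lerDl ltW.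
have := wd_lb WD (c := -1) x0t; rewrite addrAC subrr add0r => H.
apply: le_trans (H _) _; last by have := h_leM (x0 + t); have := h_ge0 x0; lra.
move=> s /andP[xs st]; apply: le_trans (L_near_peak LCP xs).
rewrite lerN2 -[leRHS](divff (lt0r_neq0 e_gt0)) ler_pM2l//.
have -> : e^-1 = t ^+ 2 by rewrite /t exprVn sqr_sqrtr// ltW.
by rewrite lerXn2r ?nnegrE//; lra.
Qed.

(** Off the lattice the distribution function of the weight moves by at most one cell;
    below 0 it is bounded by [h0_le2]. *)
Lemma balanced_log_concave_dist y :
  `|(if 0 <= y then F (Num.truncn y) else 0) - h y / M|
    <= 4 * (e * B + e) + (6 * B + 11 + 2 * e + 4 * (e * B)) * (expR 1 * Num.sqrt e).
Proof.
have eB : 0 <= e * B by rewrite mulr_ge0 ?expR_ge0// ltW.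
have c0 : 0 <= 6 * B + 11 + 2 * e + 4 * (e * B) by have := B_ge1; have := e_gt0; lra.
apply: le_trans (_ : _ <= 4 * (e * B + e) + (6 * B + 11 + 2 * e + 4 * (e * B)) / M) _; last first.
  by rewrite lerD2l; apply: ler_wpM2l => //; exact: peak_height_le.
have Mi : 0 < M^-1 by rewrite invr_gt0.
case: ifPn => [y0|]; last first.
  rewrite -ltNge => /ltW y0; rewrite sub0r normrN ger0_norm; last by have /andP[] := hM01 y.
  have : h y / M <= 2 / M.
    by rewrite ler_pM2r//; apply: le_trans (h0_le2 LCP WD); exact: wd_mono WD _ _ y0.
  move=> /le_trans; apply; apply: ler_wpDl; first by have := e_gt0; lra.
  by rewrite ler_pM2r//; have := B_ge1; have := e_gt0; lra.
set n := Num.truncn y; have /andP[ny yn] := truncn_itv y0.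
have -> : F n - h y / M = (F n - h n%:R / M) - (h y - h n%:R) / M by ring.
apply: le_trans (ler_normB _ _) _.
have : `|(h y - h n%:R) / M| <= 1 / M.
  rewrite normrM (gtr0_norm Mi) ler_pM2r// ger0_norm ?subr_ge0 ?(wd_mono WD)//.
  by have := h_lip LCP WD ny; move: yn; rewrite -/n -natr1; lra.
have := lattice_dist n; rewrite -/n; lra.
Qed.

End balanced_vs_log_concave.

(** * Integrals of nonincreasing functions *)

Section integral_of_nonincreasing.
Context (R : realType) (f : R -> R).
Hypothesis f_ninc : forall x y, x <= y -> f y <= f x.
Local Notation leb := (@lebesgue_measure R).
Local Notation I := (fun x => oriented_integral 0 x f).

Lemma integrable_nonincreasing (a b : R) : leb.-integrable `[a, b] (EFin \o f).
Proof.
apply: measurable_bounded_integrable => //.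
- by rewrite /= lebesgue_measure_itv/=; case: ifP => _; rewrite ?EFinN -?EFinB ltry.
- by apply: nonincreasing_measurable => // x y; exact: f_ninc.
exists (`|f a| + `|f b|); split; first by rewrite num_real.
move=> M fM x /=; rewrite in_itv/= => /andP[ax xb]; apply/ltW/(le_lt_trans _ fM).
have := f_ninc ax; have := f_ninc xb; rewrite ler_norml => ? ?.
have := ler_norm (f a); have := ler_norm (- f b); rewrite normrN.
have := normr_ge0 (f a); have := normr_ge0 (f b).
by move=> *; apply/andP; split; lra.
Qed.

Lemma oriented_integralB x y : x <= y -> I y - I x = \int[leb]_(t in `[x, y]) f t.
Proof.
have itv (a b c : R) : a <= b -> b <= c ->
    \int[leb]_(t in `[a, c]) f t - \int[leb]_(t in `[a, b]) f t
    = \int[leb]_(t in `[b, c]) f t.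
  move=> ab bc; rewrite Rintegral_itvB ?bnd_simp//; last exact: integrable_nonincreasing.
  rewrite Rintegral_itv_obnd_cbnd//.
  apply: integrableS (integrable_nonincreasing b c) => //.
  by apply: subset_itvr; rewrite bnd_simp.
move=> xy; rewrite /oriented_integral.
case: (leP 0 x) => x0.
  by rewrite (le_trans x0 xy) itv.
case: (leP 0 y) => y0; first by rewrite opprK -(itv x 0 y) ?(ltW x0)// addrC addrCA subrr addr0.
by rewrite opprK addrC -(itv x y 0) ?(ltW y0)// opprB addrCA subrr addr0.
Qed.

Lemma oriented_integralB_bounds x y : x <= y ->
  (y - x) * f y <= I y - I x <= (y - x) * f x.
Proof.
move=> xy; rewrite (oriented_integralB xy).
have cst c : \int[leb]_(t in `[x, y]) c = (y - x) * c.
  rewrite Rintegral_cst//= lebesgue_measure_itv/= mulrC; congr (_ * _).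
  move: xy; rewrite le_eqVlt lte_fin => /predU1P[->|->//].
  by rewrite ltxx subrr.
have intc c : leb.-integrable `[x, y] (EFin \o (fun=> c)).
  apply: measurable_bounded_integrable => //; last exact: bounded_cst.
  by rewrite /= lebesgue_measure_itv/=; case: ifP => _; rewrite ?EFinN -?EFinB ltry.
rewrite -(cst (f x)) -(cst (f y)); apply/andP; split.
  apply: le_Rintegral => //; first exact: integrable_nonincreasing.
  by move=> t /=; rewrite in_itv/= => /andP[_ ty]; exact: f_ninc.
apply: le_Rintegral => //; first exact: integrable_nonincreasing.
by move=> t /=; rewrite in_itv/= => /andP[xt _]; exact: f_ninc.
Qed.

Lemma measurable_oriented_integral : f 0 = 0 -> measurable_fun [set: R] I.
Proof.
move=> f0.
have I0 : I 0 = 0.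
  by rewrite /oriented_integral lexx set_itv1 Rintegral_set1.
(* The integral increases up to 0 and decreases after, and so is a sum of two
   monotone functions. *)
have -> : I = (fun x => I (Num.min x 0) + I (Num.max x 0)).
  apply/funext => x; rewrite /Num.min /Num.max; case: ifP => _; by rewrite I0 ?addr0 ?add0r.
apply: measurable_funD.
  apply: nondecreasing_measurable => // x y xy.
  have mxy : Num.min x 0 <= Num.min y 0 by rewrite le_min !ge_min xy lexx orbT.
  have /andP[lb _] := oriented_integralB_bounds mxy.
  have fy : 0 <= f (Num.min y 0).
    by rewrite -[leLHS]f0; apply: f_ninc; rewrite ge_min lexx orbT.
  by rewrite -subr_ge0; apply: le_trans lb; rewrite mulr_ge0// subr_ge0.
apply: nonincreasing_measurable => // x y xy.
have mxy : Num.max x 0 <= Num.max y 0 by rewrite ge_max !le_max xy lexx orbT.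
have /andP[_ ub] := oriented_integralB_bounds mxy.
have fx : f (Num.max x 0) <= 0.
  by rewrite -[leRHS]f0; apply: f_ninc; rewrite le_max lexx orbT.
by rewrite -subr_le0; apply: le_trans ub _; rewrite mulr_ge0_le0// subr_ge0.
Qed.

End integral_of_nonincreasing.

(** * The Erlang-A drift and its limit law *)

Section erlangA_potential.
Context (R : realType) (n : nat) (lambda mu alpha : R).
Hypotheses (lambda_gt0 : 0 < lambda) (mu_gt0 : 0 < mu)
  (alpha_gt0 : 0 < alpha).

Local Notation load := (offered_load lambda mu).
Local Notation dlt := (delta lambda mu).
Local Notation xinf := (fluid_equilibrium n lambda mu alpha).
Local Notation b := (drift n lambda mu alpha).

(** For integers [y] this is the total death rate over [lambda], minus 1 (see
    [excess_rate_nat]): [y /\ n] is written [n - neg_part (y - n)], which continues it to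
    negative [y]. *)
Definition relative_excess_rate (y : R) : R :=
  (n%:R - neg_part (y - n%:R) + alpha / mu * pos_part (y - n%:R)) / load - 1.

Definition log_weight (y : R) : R := 1 / mu * oriented_integral 0 (dlt * (y - xinf)) b.

Local Notation z := relative_excess_rate.

Lemma pos_part_ge0 (x : R) : 0 <= x -> pos_part x = x.
Proof. by move=> x0; rewrite /pos_part max_l. Qed.
Lemma pos_part_le0 (x : R) : x <= 0 -> pos_part x = 0.
Proof. by move=> x0; rewrite /pos_part max_r. Qed.
Lemma neg_part_ge0 (x : R) : 0 <= x -> neg_part x = 0.
Proof. by move=> x0; rewrite /neg_part max_r// oppr_le0. Qed.
Lemma neg_part_le0 (x : R) : x <= 0 -> neg_part x = - x.
Proof. by move=> x0; rewrite /neg_part max_l// oppr_ge0. Qed.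

Lemma pos_partM (s x : R) : 0 < s -> pos_part (s * x) = s * pos_part x.
Proof. by move=> s0; rewrite /pos_part maxr_pMr ?mulr0// ltW. Qed.
Lemma neg_partM (s x : R) : 0 < s -> neg_part (s * x) = s * neg_part x.
Proof. by move=> s0; rewrite /neg_part maxr_pMr ?mulr0 ?mulrN// ltW. Qed.

Lemma pos_part_lip (x y : R) : x <= y -> 0 <= pos_part y - pos_part x <= y - x.
Proof.
move=> xy; case: (leP 0 x) => [x0|/ltW x0].
  by rewrite (pos_part_ge0 x0) (pos_part_ge0 (le_trans x0 xy)) subr_ge0 xy lexx.
rewrite (pos_part_le0 x0); case: (leP 0 y) => [y0|/ltW y0].
  by rewrite pos_part_ge0//; apply/andP; split; lra.
by rewrite pos_part_le0//; apply/andP; split; lra.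
Qed.

Lemma neg_part_lip (x y : R) : x <= y -> 0 <= neg_part x - neg_part y <= y - x.
Proof.
move=> xy; have := @pos_part_lip (- y) (- x); rewrite lerN2 => /(_ xy).
by rewrite /pos_part /neg_part; lra.
Qed.

Lemma load_gt0 : 0 < load. Proof. by rewrite divr_gt0. Qed.

Lemma delta_gt0 : 0 < dlt. Proof. by rewrite divr_gt0// sqrtr_gt0 load_gt0. Qed.

Lemma delta_sqr : dlt ^+ 2 = load^-1.
Proof. by rewrite /delta div1r exprVn sqr_sqrtr// ltW// load_gt0. Qed.

Lemma fluid_equilibrium_ge0 : 0 <= xinf.
Proof.
rewrite /fluid_equilibrium; case: ifP => [nR|_]; last exact/ltW/load_gt0.
rewrite addr_ge0// divr_ge0 ?(ltW alpha_gt0)// subr_ge0.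
by rewrite -ler_pdivlMr.
Qed.

(** At the fluid equilibrium the death rate equals the arrival rate, in both regimes. *)
Lemma fluid_equilibrium_balance :
  neg_part (xinf - n%:R) - alpha / mu * pos_part (xinf - n%:R) = n%:R - load.
Proof.
rewrite /fluid_equilibrium; case: ifPn => [nR|]; last first.
  rewrite -ltNge => /ltW Rn; rewrite neg_part_le0 ?pos_part_le0 ?subr_le0//.
  by rewrite mulr0 subr0 opprB.
have d0 : 0 <= (lambda - n%:R * mu) / alpha.
  by rewrite divr_ge0 ?(ltW alpha_gt0)// subr_ge0 -ler_pdivlMr.
rewrite addrAC subrr add0r neg_part_ge0// pos_part_ge0// /offered_load.
by field; rewrite !gt_eqF.
Qed.

(** The drift of the diffusion is the rate imbalance of the chain, rescaled: the
    constants [neg_part zeta] and [pos_part zeta] amount to the balance at equilibrium. *)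
Lemma scaled_drift y : dlt * b (dlt * (y - xinf)) = - (mu * z y).
Proof.
have d0 := delta_gt0.
have -> : b (dlt * (y - xinf)) =
    dlt * (mu * ((neg_part (y - n%:R) - alpha / mu * pos_part (y - n%:R))
      - (neg_part (xinf - n%:R) - alpha / mu * pos_part (xinf - n%:R)))).
  rewrite /drift /zeta -mulrDr.
  have -> : y - xinf + (xinf - n%:R) = y - n%:R by ring.
  rewrite !neg_partM// !pos_partM//; field; rewrite gt_eqF//.
rewrite fluid_equilibrium_balance mulrA -expr2 delta_sqr /relative_excess_rate.
by field; rewrite !gt_eqF// load_gt0.
Qed.

Lemma drift_ninc x y : x <= y -> b y <= b x.
Proof.
move=> xy; rewrite /drift.
have xyz : x + zeta n lambda mu alpha <= y + zeta n lambda mu alpha by rewrite lerD2r.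
have /andP[p1 p2] := pos_part_lip xyz; have /andP[n1 n2] := neg_part_lip xyz.
by have := mulr_ge0 p1 (ltW alpha_gt0); have := mulr_ge0 n1 (ltW mu_gt0); lra.
Qed.

Lemma drift0 : b 0 = 0.
Proof. by rewrite /drift !add0r !subrr !mul0r subrr. Qed.

Lemma excess_rate_lip x y : x <= y ->
  0 <= z y - z x <= (1 + alpha / mu) * dlt ^+ 2 * (y - x).
Proof.
move=> xy; have xyn : x - n%:R <= y - n%:R by rewrite lerD2r.
have /andP[p1 p2] := pos_part_lip xyn; have /andP[n1 n2] := neg_part_lip xyn.
have c0 : 0 < alpha / mu by rewrite divr_gt0.
have -> : z y - z x = ((neg_part (x - n%:R) - neg_part (y - n%:R))
    + alpha / mu * (pos_part (y - n%:R) - pos_part (x - n%:R))) / load.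
  by rewrite /relative_excess_rate; ring.
rewrite delta_sqr; apply/andP; split.
  by rewrite divr_ge0 ?(ltW load_gt0)// addr_ge0// mulr_ge0// ltW.
rewrite [leRHS]mulrAC ler_pM2r ?invr_gt0 ?load_gt0//.
have := ler_wpM2l (ltW c0) p2; lra.
Qed.

Lemma log_weight_bounds x y : x <= y ->
  - (y - x) * z y <= log_weight y - log_weight x <= - (y - x) * z x.
Proof.
move=> xy; have d0 := delta_gt0.
have sxy : dlt * (x - xinf) <= dlt * (y - xinf) by rewrite ler_pM2l// lerD2r.
have E t : (dlt * (y - xinf) - dlt * (x - xinf)) * b (dlt * (t - xinf))
    = - (y - x) * z t * mu.
  transitivity ((y - x) * (dlt * b (dlt * (t - xinf)))); first by ring.
  by rewrite scaled_drift; ring.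
have := oriented_integralB_bounds drift_ninc sxy; rewrite !E.
rewrite /log_weight -mulrBr div1r [mu^-1 * _]mulrC ler_pdivrMr// ler_pdivlMr//.
Qed.

Lemma erlangA_log_concave :
  log_concave_potential z log_weight xinf ((1 + alpha / mu) * dlt ^+ 2).
Proof.
split.
- by rewrite mulr_gt0 ?exprn_gt0 ?delta_gt0// addr_gt0// divr_gt0.
- exact: fluid_equilibrium_ge0.
- have /eqP := scaled_drift xinf.
  rewrite subrr mulr0 drift0 mulr0 eq_sym oppr_eq0 mulf_eq0 (gt_eqF mu_gt0).
  by move=> /eqP.
- by rewrite /log_weight subrr mulr0 /oriented_integral lexx set_itv1 Rintegral_set1 mulr0.
- rewrite /relative_excess_rate sub0r neg_part_le0 ?oppr_le0//.
  by rewrite pos_part_le0 ?oppr_le0// mulr0 opprK subrr add0r mul0r sub0r.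
- by move=> x y /excess_rate_lip/andP[+ _]; rewrite subr_ge0.
- by move=> x y /excess_rate_lip/andP[_]; lra.
- by move=> x y /log_weight_bounds/andP[].
- by move=> x y /log_weight_bounds/andP[].
Qed.

Lemma excess_rate_nat k :
  erlangA_death n mu alpha k = lambda * (1 + z k%:R).
Proof.
rewrite /erlangA_death /relative_excess_rate /offered_load.
case: (leqP k n) => kn.
  have kn' : k%:R - n%:R <= 0 :> R by rewrite subr_le0 ler_nat.
  have -> : (k - n)%N = 0%N by apply/eqP; rewrite subn_eq0.
  rewrite neg_part_le0// pos_part_le0//; field; rewrite !gt_eqF//.
have kn' : 0 <= k%:R - n%:R :> R by rewrite subr_ge0 ler_nat ltnW.
rewrite natrB ?(ltnW kn)// neg_part_ge0// pos_part_ge0//.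
by field; rewrite !gt_eqF.
Qed.

Lemma expR_log_weight y :
  expR (log_weight y) = diffusion_weight n lambda mu alpha (dlt * (y - xinf)).
Proof. by []. Qed.

Lemma measurable_diffusion_weight :
  measurable_fun [set: R] (diffusion_weight n lambda mu alpha).
Proof.
apply: measurableT_comp => //; apply: measurable_funM => //.
exact: measurable_oriented_integral drift_ninc drift0.
Qed.

Section limit_distribution.
Context (d : measure_display) (T : measurableType d) (Pr : probability T R)
  (Y : {RV Pr >-> R}) (kappa : R).
Hypotheses (kappa_gt0 : 0 < kappa)
  (Yd : has_density Y (fun x => kappa * diffusion_weight n lambda mu alpha x)).

Local Notation H := (fun x => fine (cdf Y x)).
Local Notation leb := (@lebesgue_measure R).

Lemma cdfB_bounds x y c c' : x <= y ->
  (forall t, x <= t <= y -> c <= diffusion_weight n lambda mu alpha t <= c') -> 0 <= c ->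
  (y - x) * (kappa * c) <= H y - H x <= (y - x) * (kappa * c').
Proof.
move=> xy cc' c0.
have fH t : cdf Y t = (H t)%:E by rewrite fineK// fin_num_measure.
have mw D : measurable_fun D
    (fun t => (kappa * diffusion_weight n lambda mu alpha t)%:E).
  apply/measurable_EFinP; apply: measurable_funTS.
  by apply: measurable_funM => //; exact: measurable_diffusion_weight.
have HE : (H y - H x)%:E =
    (\int[leb]_(t in `]x, y]) (kappa * diffusion_weight n lambda mu alpha t)%:E)%E.
  rewrite -Yd// EFinB -!fH /cdf.
  have -> : `]-oo, y]%classic = `]-oo, x] `|` `]x, y] :> set R.
    by rewrite -itv_bndbnd_setU// bnd_simp.
  rewrite measureU//=; last first.
    apply/seteqP; split=> // t [/=]; rewrite !in_itv/= => tx /andP[xt _].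
    by move: (lt_le_trans xt tx); rewrite ltxx.
  by rewrite addeAC subee ?add0e// fin_num_measure.
have cst a : (\int[leb]_(t in `]x, y]) (kappa * a)%:E = ((y - x) * (kappa * a))%:E)%E.
  rewrite integral_cst//= lebesgue_measure_itv/= [in RHS]mulrC [in RHS]EFinM; congr (_ * _)%E.
  move: xy; rewrite le_eqVlt lte_fin => /predU1P[->|->//].
  by rewrite ltxx subrr.
rewrite -!lee_fin HE -!cst; apply/andP; split; apply: ge0_le_integral => //=; try exact: mw.
- by move=> t _; rewrite lee_fin mulr_ge0// ltW.
- move=> t; rewrite in_itv/= => /andP[/ltW xt ty]; rewrite lee_fin ler_pM2l//.
  by have /andP[] := cc' t (introT andP (conj xt ty)).
- by move=> t _; rewrite lee_fin mulr_ge0 ?expR_ge0// ltW.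
- move=> t; rewrite in_itv/= => /andP[/ltW xt ty]; rewrite lee_fin ler_pM2l//.
  by have /andP[] := cc' t (introT andP (conj xt ty)).
Qed.

Let H_cvg (F : set_system R) (l : R) (s : nat -> R) :
  (fine \o cdf Y) @ F --> l -> s @ \oo --> F -> (fun k => H (s k)) @ \oo --> l.
Proof. by move=> Hl sF; exact: cvg_trans (cvg_app _ sF) Hl. Qed.

Lemma erlangA_weight_distribution :
  weight_distribution log_weight
    (fun y => H (dlt * (y - xinf)) / (kappa * dlt)) (kappa * dlt)^-1.
Proof.
have kd : 0 < kappa * dlt by rewrite mulr_gt0// delta_gt0.
have d0 := delta_gt0.
have dd t : t = dlt * ((t / dlt + xinf) - xinf) by rewrite addrK mulrC divfK// gt_eqF.
have sxy x y : x <= y -> dlt * (x - xinf) <= dlt * (y - xinf).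
  by move=> xy; rewrite ler_pM2l// lerD2r.
have itv x y t : dlt * (x - xinf) <= t <= dlt * (y - xinf) -> x <= t / dlt + xinf <= y.
  by rewrite [in X in X -> _](dd t) !ler_pM2l// !lerD2r.
have len x y : dlt * (y - xinf) - dlt * (x - xinf) = (y - x) * dlt by ring.
split.
- move=> x y c xy Lc; rewrite -mulrBl ler_pdivrMr//.
  have W t : dlt * (x - xinf) <= t <= dlt * (y - xinf) ->
      0 <= diffusion_weight n lambda mu alpha t <= expR c.
    by move=> /itv /Lc; rewrite -ler_expR expR_log_weight -dd => ->; rewrite expR_ge0.
  have /andP[_ /le_trans] := cdfB_bounds (sxy _ _ xy) W (lexx 0).
  by apply; rewrite len; lra.
- move=> x y c xy Lc; rewrite -mulrBl ler_pdivlMr//.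
  have W t : dlt * (x - xinf) <= t <= dlt * (y - xinf) ->
      expR c <= diffusion_weight n lambda mu alpha t <= 1.
    move=> /itv /Lc; rewrite -ler_expR expR_log_weight -dd => -> /=.
    by rewrite (dd t) -expR_log_weight; exact: weight_le1 erlangA_log_concave _.
  have /andP[+ _] := cdfB_bounds (sxy _ _ xy) W (expR_ge0 c).
  by apply: le_trans; rewrite len; lra.
- move=> x y /sxy xy; rewrite ler_pM2r ?invr_gt0//.
  by rewrite fine_le ?fin_num_measure// cdf_nondecreasing.
- by move=> x; rewrite divr_ge0 ?fine_ge0// ltW.
- move=> x; apply: ler_piMl; first by rewrite invr_ge0 ltW.
  by rewrite -lee_fin fineK ?fin_num_measure// cdf_le1.
- rewrite -[X in _ --> X](mul0r (kappa * dlt)^-1); apply: cvgM; last exact: cvg_cst.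
  apply: (@H_cvg -oo); first exact/fine_cvg/cvg_cdfNy0.
  apply/cvgrNyPle => A; near=> k; rewrite mulrC -ler_pdivlMr// lerBlDr lerNl.
  by near: k; exact: nbhs_infty_ger.
Unshelve. all: by end_near. Qed.

Lemma erlangA_weight_total :
  H (dlt * (k%:R - xinf)) / (kappa * dlt) @[k --> \oo] --> (kappa * dlt)^-1.
Proof.
rewrite -[X in _ --> X]mul1r; apply: cvgM; last exact: cvg_cst.
apply: (@H_cvg +oo); first exact/fine_cvg/cvg_cdfy1.
apply/cvgryPge => A; near=> k; rewrite mulrC -ler_pdivrMr ?delta_gt0// lerBrDr.
by near: k; exact: nbhs_infty_ger.
Unshelve. all: by end_near. Qed.

End limit_distribution.
End erlangA_potential.

(** * Stationary birth-death chains *)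

Section nat_distribution.
Context (R : realType) (pi : probability nat R).

Lemma sum_mass_le_integral (g : nat -> \bar R) N : (forall i, 0 <= g i)%E ->
  (\sum_(i < N) pi [set val i] * g i <= \int[pi]_i g i)%E.
Proof.
move=> g0.
have -> : (\sum_(i < N) pi [set val i] * g i =
    \int[pi]_j \sum_(i < N) (g i * (\1_[set val i] j)%:E))%E.
  rewrite ge0_integral_sum//.
    apply: eq_bigr => i _; rewrite ge0_integralZl// integral_indic//.
    by rewrite setIT muleC.
  by move=> i j _; rewrite mule_ge0.
apply: ge0_le_integral => //.
  by move=> j _; apply: sume_ge0 => i _; rewrite mule_ge0.
move=> j _; have [jN|Nj] := ltnP j N.
  rewrite (bigD1 (Ordinal jN))//= indicE mem_set// mule1 big1 ?adde0//.
  move=> i /eqP ij; rewrite indicE memNset ?mule0// => /= ji.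
  by apply: ij; apply: val_inj.
rewrite big1// => i _; rewrite indicE memNset ?mule0// => /= ji.
by move: (ltn_ord i); rewrite -ji ltnNge Nj.
Qed.

Lemma psum_massE n : \sum_(k < n) fine (pi [set val k]) = fine (pi `I_n).
Proof.
elim: n => [|n IH]; first by rewrite big_ord0 II0 measure0.
rewrite big_ord_recr/= IH IIS measureU//=.
  by rewrite fineD// fin_num_measure.
by apply/seteqP; split=> // k /= [kn kE]; move: kn; rewrite kE ltnn.
Qed.

Lemma mass_psum_cvg : \sum_(k < n) fine (pi [set val k]) @[n --> \oo] --> (1 : R).
Proof.
under eq_fun do rewrite psum_massE.
have : (pi \o (fun n => `I_n)) x @[x --> \oo] --> pi (\bigcup_n `I_n).
  apply: nondecreasing_cvg_mu => //.
  by move=> m n mn; apply/subsetPset => k /= /leq_trans; exact.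
have -> : \bigcup_n `I_n = [set: nat].
  by apply/seteqP; split=> // k _; exists k.+1 => //=.
by rewrite probability_setT => /fine_cvg.
Qed.

End nat_distribution.

Section stationary_birth_death.
Context (R : realType) (lambda : R) (death : nat -> R) (P : R -> R.-pker nat ~> nat)
  (pi : probability nat R).
Hypotheses (lambda_ge0 : 0 <= lambda) (death_ge0 : forall k, 0 <= death k)
  (death0 : death 0%N = 0)
  (bdP : birth_death_process (fun=> lambda) death P) (piP : stationary P pi).

Local Notation p := (fun k => fine (pi [set k])).
Local Notation rate := (birth_death_rate (fun=> lambda) death).

Let p_ge0 k : 0 <= p k. Proof. exact: fine_ge0. Qed.

(** Stationarity at time [h] with only the starting states below [j + 2] kept is an
    inequality between finite sums, so it can be divided by [h] and passed to the
    limit without exchanging the limit with an infinite sum. *)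
Lemma generator_column_le0 j : \sum_(i < j.+2) p i * rate i j <= 0.
Proof.
have step h : 0 < h ->
    \sum_(i < j.+2) p i * ((fine (P h i [set j]) - (val i == j)%:R) / h) <= 0.
  move=> h0; have finp i : pi [set i] = (p i)%:E by rewrite fineK// fin_num_measure.
  have finP i : P h i [set j] = (fine (P h i [set j]))%:E.
    by rewrite fineK//; exact: finite_kernel_measure.
  have := @sum_mass_le_integral _ pi (fun i => P h i [set j]) j.+2 (fun=> measure_ge0 _ _).
  rewrite (piP _ (ltW h0)) finp.
  have -> : (\sum_(i < j.+2) pi [set val i] * P h i [set j])%E =
      (\sum_(i < j.+2) p i * fine (P h i [set j]))%:E.
    by rewrite -sumEFin; apply: eq_bigr => i _; rewrite EFinM -finp -finP.
  rewrite lee_fin => le_pj.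
  under eq_bigr do rewrite mulrA; rewrite -mulr_suml.
  rewrite pmulr_lle0 ?invr_gt0//.
  under eq_bigr do rewrite mulrBr; rewrite sumrB subr_le0; apply: le_trans le_pj _.
  rewrite (bigD1 (Ordinal (leqnSn j.+1)))//= eqxx mulr1 lerDl sumr_ge0// => i _.
  by rewrite mulr_ge0.
have cvg_step : \sum_(i < j.+2) p i * ((fine (P h i [set j]) - (val i == j)%:R) / h)
    @[h --> 0^'+] --> \sum_(i < j.+2) p i * rate i j.
  apply: cvg_big => [|i _]; first exact: add_continuous.
  apply: cvgM; first exact: cvg_cst.
  exact: birth_death_generator bdP i j.
apply: (cvgr_to_le cvg_step); near=> h; apply: step.
by near: h; exact: nbhs_right_gt.
Unshelve. all: by end_near. Qed.

(** The column sum is the net flux from [j + 1] to [j] minus the net flux from [j] to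
    [j - 1]. *)
Lemma generator_columnE j : \sum_(i < j.+2) p i * rate i j =
  p j.+1 * death j.+1 - p j * lambda
  - (p j * death j - (if j is j'.+1 then p j' * lambda else 0)).
Proof.
have r1 k : rate k.+1 k = death k.+1.
  by rewrite /birth_death_rate eqxx (ltn_eqF (leqnSn k.+1)).
have r0 k : rate k k = - (lambda + death k).
  by rewrite /birth_death_rate (ltn_eqF (ltnSn k)) eqxx.
have rS k : rate k k.+1 = lambda by rewrite /birth_death_rate eqxx.
rewrite !big_ord_recr/= r1 r0; case: j => [|j].
  by rewrite big_ord0 death0; ring.
rewrite big_ord_recr/= rS big1 ?add0r; first by ring.
move=> i _; rewrite /birth_death_rate.
have ij := ltn_ord i.
by rewrite eqSS gtn_eqF// !ltn_eqF ?mulr0// ltnW// !ltnS ltnW.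
Qed.

(** The net flux [f] is nonincreasing and starts at a nonpositive value, while
    [f k >= - p k * lambda], which tends to 0; hence it is zero throughout. *)
Lemma detailed_balance k : lambda * p k = death k.+1 * p k.+1.
Proof.
pose f k := p k.+1 * death k.+1 - p k * lambda.
have f_ninc j : f j.+1 <= f j.
  have := generator_column_le0 j.+1; rewrite generator_columnE.
  by rewrite -/(f j.+1) -/(f j) subr_le0.
have f0 : f 0%N <= 0.
  have := generator_column_le0 0; rewrite generator_columnE.
  by rewrite -/(f 0%N) death0 mulr0 !subr0.
have f_le0 j : f j <= 0 by elim: j => // j; exact: le_trans.
have f_mono i j : (i <= j)%N -> f j <= f i.
  by move=> /subnKC <-; elim: (j - i)%N => [|l IH]; rewrite ?addn0// addnS; exact: le_trans IH.
have p_cvg0 : p k @[k --> \oo] --> (0 : R).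
  have pc := mass_psum_cvg pi.
  have : (\sum_(i < k.+1) p i - \sum_(i < k) p i) @[k --> \oo] --> (1 - 1 : R).
    by apply: cvgB => //; rewrite (cvg_shiftS (fun k => \sum_(i < k) p i)).
  rewrite subrr; apply: cvg_trans; apply: near_eq_cvg; near=> i.
  by rewrite big_ord_recr/= addrAC subrr add0r.
have f_ge0 : 0 <= f k.
  have c : - (p j * lambda) @[j --> \oo] --> - (0 * lambda).
    by apply: cvgN; apply: cvgM => //; exact: cvg_cst.
  rewrite mul0r oppr0 in c; apply: (cvgr_to_le c); near=> j.
  apply: (@le_trans _ _ (f j)); first by rewrite /f lerBrDr addrC subrr mulr_ge0.
  by apply: f_mono; near: j; exact: nbhs_infty_ge.
have : f k = 0 by apply/eqP; rewrite eq_le f_le0 f_ge0.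
by rewrite /f => /eqP; rewrite subr_eq0 => /eqP; lra.
Unshelve. all: by end_near. Qed.

End stationary_birth_death.

(** * The Kolmogorov bound *)

(** With [s = 1 + c >= 1]: [e <= s * dlt], [e <= s] and [Num.sqrt e <= s * dlt],
    and every term of the second factor is at most its coefficient times
    [s * expR s], which gives [23 = 6 + 11 + 2 + 4]. *)
Lemma error_term_le (R : realType) (c dlt e : R) :
  0 <= c -> 0 < dlt -> dlt <= 1 -> e = (1 + c) * dlt ^+ 2 ->
  4 * (e * expR e + e) + (6 * expR e + 11 + 2 * e + 4 * (e * expR e)) * (expR 1 * Num.sqrt e)
    <= (8 + 23 * expR 1) * ((1 + c) ^+ 2 * expR (1 + c)) * dlt.
Proof.
move=> c0 d0 d1 eE; set B := expR e; set s := 1 + c; set E := expR s.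
have s1 : 1 <= s by rewrite lerDl.
have d2 : dlt ^+ 2 <= dlt by rewrite expr2 ler_piMr// ltW.
have e0 : 0 <= e by rewrite eE mulr_ge0 ?exprn_ge0 ?(ltW d0)//; lra.
have esd : e <= s * dlt by rewrite eE -/s ler_wpM2l//; lra.
have es : e <= s by apply: le_trans esd _; rewrite ler_piMr//; lra.
have BE : B <= E by rewrite ler_expR.
have E1 : 1 <= E by rewrite -expR0 ler_expR; lra.
have B0 : 0 <= B := expR_ge0 _.
have se : Num.sqrt e <= s * dlt.
  rewrite eE -/s sqrtrM; last by lra.
  rewrite sqrtr_sqr gtr0_norm// ler_pM2r//.
  rewrite -[leRHS]gtr0_norm; last by lra.
  by rewrite -sqrtr_sqr ler_wsqrtr// expr2 ler_peMr//; lra.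
have sE1 : 1 <= s * E by rewrite mulr_ege1.
have sE_ge_s : s <= s * E by rewrite ler_peMr//; lra.
have sE_ge_E : E <= s * E by rewrite ler_peMl//; lra.
have eB : e * B <= s * E by apply: ler_pM.
have t1 : 4 * (e * B + e) <= 8 * (s * E) * dlt.
  have : e * B <= s * dlt * E by apply: ler_pM.
  have : e <= s * dlt * E by apply: le_trans esd _; rewrite ler_peMr// mulr_ge0 ?ltW//; lra.
  lra.
have t2 : (6 * B + 11 + 2 * e + 4 * (e * B)) * (expR 1 * Num.sqrt e)
    <= 23 * (s * E) * (expR 1 * (s * dlt)).
  apply: ler_pM => //.
  - by have := mulr_ge0 e0 B0; lra.
  - lra.
  - by rewrite ler_wpM2l ?expR_ge0.
apply: le_trans (lerD t1 t2) _.
have : s * E * dlt <= s ^+ 2 * E * dlt.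
  by rewrite ler_pM2r// expr2 -mulrA ler_peMl// mulr_ge0//; lra.
by lra.
Qed.

Lemma scaled_cdfE (R : realType) (n : nat) (lambda mu alpha : R)
    (d : measure_display) (T : measurableType d) (Pr : probability T R)
    (X : {RV Pr >-> nat}) (a : R) : 0 < lambda -> 0 < mu ->
  let y := a / delta lambda mu + fluid_equilibrium n lambda mu alpha in
  fine (cdf (scaled_count n lambda mu alpha X) a) =
  if 0 <= y then \sum_(k < (Num.truncn y).+1) fine (distribution Pr X [set val k]) else 0.
Proof.
move=> l0 m0 y; have d0 : 0 < delta lambda mu by exact: delta_gt0.
have memE k : (centered_scaled (delta lambda mu) (fluid_equilibrium n lambda mu alpha) k <= a)
    = (k%:R <= y).
  by rewrite /centered_scaled /y mulrC -ler_pdivlMr// lerBlDr.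
rewrite /cdf /distribution /pushforward.
case: ifPn => [y0|]; last first.
  rewrite -ltNge => y0; rewrite (_ : _ @^-1` _ = set0) ?measure0//.
  apply/seteqP; split=> // t /=; rewrite in_itv/= memE => /le_lt_trans/(_ y0).
  by rewrite ltrn0.
rewrite (psum_massE (distribution Pr X)); congr fine; congr (Pr _).
apply/seteqP; split=> t /=; rewrite in_itv/= memE; first by rewrite ltnS truncn_ge_nat.
by rewrite ltnS truncn_ge_nat.
Qed.

Theorem theorem2p3 (R : realType) :
  exists C_K : R -> R,
    (forall x : R, 0 <= x -> 0 <= C_K x) /\
    (forall x y : R, 0 <= x -> x < y -> C_K x < C_K y) /\
    forall (n : nat) (lambda mu alpha : R),
      (1 <= n)%N -> 0 < lambda -> 0 < mu -> 0 < alpha ->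
      1 <= offered_load lambda mu ->
    forall (P : R -> R.-pker nat ~> nat),
      erlangA_process n lambda mu alpha P ->
    forall (d : measure_display) (T : measurableType d) (Pr : probability T R)
      (X : {RV Pr >-> nat}),
      stationary P (distribution Pr X) ->
    forall (d' : measure_display) (T' : measurableType d') (Pr' : probability T' R)
      (Y : {RV Pr' >-> R}) (kappa : R),
      0 < kappa ->
      has_density Y (fun x => kappa * diffusion_weight n lambda mu alpha x) ->
    kolmogorov_distance (scaled_count n lambda mu alpha X) Y
      <= C_K (alpha / mu) * delta lambda mu.
Proof.
exists (fun x => (8 + 23 * expR 1) * ((1 + x) ^+ 2 * expR (1 + x))).
have e1 : 0 < expR 1 :> R by exact: expR_gt0.
split=> [x x0|].
  by rewrite !mulr_ge0 ?expR_ge0 ?sqr_ge0// addr_ge0// mulr_ge0// ltW.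
split=> [x y x0 xy|].
  rewrite ltr_pM2l; last by rewrite addr_gt0// mulr_gt0.
  have x1 : 0 <= 1 + x by lra.
  by apply: ltr_pM; rewrite ?sqr_ge0 ?expR_ge0 ?ltr_expR ?ltrXn2r ?nnegrE ?ltrD2l//; lra.
move=> n lambda mu alpha n0 l0 m0 a0 R1 P bdP d T Pr X piP d' T' Pr' Y kappa k0 Yd.
have d0 : 0 < delta lambda mu by exact: delta_gt0.
have d1 : delta lambda mu <= 1.
  rewrite -(@expr_le1 _ 2 _ isT (ltW d0)) delta_sqr// invf_le1//; exact: load_gt0.
have c0 : 0 <= alpha / mu by rewrite divr_ge0// ltW.
set dlt := delta lambda mu in d0 d1 *; set xinf := fluid_equilibrium n lambda mu alpha.
have LCP := erlangA_log_concave n l0 m0 a0.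
have WD := erlangA_weight_distribution l0 m0 a0 k0 Yd.
have Wy := @erlangA_weight_total _ n _ _ alpha l0 m0 _ _ _ Y kappa.
set p := fun k => fine (distribution Pr X [set k]).
have p0 k : 0 <= p k by exact: fine_ge0.
have bal k : p k = (1 + relative_excess_rate n lambda mu alpha k.+1%:R) * p k.+1.
  apply: (mulfI (lt0r_neq0 l0)); rewrite mulrA -excess_rate_nat//.
  apply: detailed_balance bdP piP _ => //.
    by move=> j; rewrite addr_ge0// mulr_ge0// ltW.
  by rewrite /erlangA_death min0n sub0n !mulr0 addr0.
have kd0 : 0 < (kappa * dlt)^-1 by rewrite invr_gt0 mulr_gt0.
have main := balanced_log_concave_dist LCP WD kd0 Wy p0 bal (mass_psum_cvg _).
apply: ge_sup; first by exists `|fine (cdf (scaled_count n lambda mu alpha X) 0) - fine (cdf Y 0)|, 0.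
move=> _ [a _ <-]; apply: le_trans (error_term_le c0 d0 d1 erefl).
have := main (a / dlt + xinf); rewrite scaled_cdfE// -/dlt -/xinf -/p.
rewrite addrK mulrCA divff ?gt_eqF// mulr1 invrK divfK//.
by rewrite gt_eqF// mulr_gt0.
Qed.
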